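(* Let $n$ be a positive integer such that $\sqrt{n+1}$ is an integer. Then there is a red--blue coloring of the edges of $K_n$ such that every collection of monochromatic cycles, all of the same color, that together cover all vertices of $K_n$ contains at least $\lceil\sqrt n\,\rceil$ cycles. Specifically, this holds for the coloring obtained by partitioning $V(K_n)=A\cup B$ with $|A|=n-\lfloor\sqrt n\rfloor$ and $|B|=\lfloor\sqrt n\rfloor$, and coloring all edges inside $A$ blue and all remaining edges red.
   Context: A single vertex and a single edge (with its two endpoints) are regarded as (degenerate) cycles. A single vertex counts as a monochromatic cycle of either color; a single edge counts as a monochromatic cycle of its own color. A non-degenerate cycle (on at least $3$ vertices) is monochromatic of a given color if all its edges have that color. The cycles in a cover are allowed to intersect. *)

(* Defs.v *)
From mathcomp Require Import all_boot.

Set Implicit Arguments.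
Unset Strict Implicit.
Unset Printing Implicit Defensive.

Inductive color := Red | Blue.

(* The edges of the complete graph on V. *)
Definition edge (V : finType) := {e : {set V} | #|e| == 2}.

Definition edge_coloring (V : finType) := edge V -> color.

(* A subgraph of the complete graph, as a pair (vertex set, edge set). *)
Definition subgraph (V : finType) := ({set V} * {set {set V}})%type.

(* The edges of the closed walk visiting s in cyclic order; [next s] wraps
   around from the last item to the first. *)
Definition cycle_edges (V : finType) (s : seq V) : {set {set V}} :=
  [set [set x; next s x] | x in s].

Inductive mono_cycle (V : finType) (c : edge_coloring V) (k : color) :
    subgraph V -> Prop :=
| MonoVertex (v : V) : mono_cycle c k ([set v], set0)
| MonoEdge (e : edge V) : c e = k -> mono_cycle c k (val e, [set val e])
| MonoCycle (s : seq V) :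
    uniq s -> 3 <= size s ->
    (forall e : edge V, val e \in cycle_edges s -> c e = k) ->
    mono_cycle c k ([set x in s], cycle_edges s).

(* All the members of C have the same color k; they may overlap. *)
Definition mono_cycle_cover (V : finType) (c : edge_coloring V) (k : color)
    (C : {set subgraph V}) : Prop :=
  (forall H : subgraph V, H \in C -> mono_cycle c k H) /\
  \bigcup_(H in C) H.1 = [set: V].

Definition inside_coloring (V : finType) (A : {set V}) : edge_coloring V :=
  fun e => if val e \subset A then Blue else Red.

(* Main.v *)
Require Import Defs.
From mathcomp Require Import all_boot all_order all_algebra.
From mathcomp Require Import reals.
From mathcomp Require Import zify.

Set Implicit Arguments.
Unset Strict Implicit.
Unset Printing Implicit Defensive.

Import Order.TTheory GRing.Theory Num.Theory.
Local Open Scope ring_scope.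

(** Write [n + 1 = (m + 1) ^ 2], so that [|B| = m] and [|A| = (m + 1) m].
    A red cycle never visits two vertices of [A] in a row, so it covers at most
    [m] of them and [m + 1] red cycles are needed. No blue edge meets [B], so a
    blue cover contains each vertex of [B] as a singleton, and at least one
    further cycle to cover [A]. *)

Lemma next_neq (T : eqType) (s : seq T) (x : T) :
  uniq s -> (1 < size s)%N -> x \in s -> x != next s x.
Proof.
move=> us s_gt1 /rot_to [i p sE].
rewrite -(next_rot i us) sE.
have := us; have := s_gt1; rewrite -(rot_uniq i) -(size_rot i) sE.
case: p {sE} => //= y p _; rewrite eqxx inE negb_or.
by case/andP => /andP[].
Qed.

(** Colors are given only to sets packaged with a proof of having two elements. This packages the
    pair formed by [x] and its successor, so that the color hypothesis on a long cycle can be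
    applied to it. *)
Lemma cycle_edgeP (V : finType) (s : seq V) (x : V) :
  uniq s -> (2 < size s)%N -> x \in s ->
  exists2 e : edge V, val e = [set x; next s x] & val e \in cycle_edges s.
Proof.
move=> us /ltnW s_gt1 xs.
have xe : #|[set x; next s x]| == 2 by rewrite cards2 next_neq.
by exists (exist (fun e : {set V} => #|e| == 2) _ xe) => //=; apply: imset_f.
Qed.

Section InsideColoring.
Variables (V : finType) (A : {set V}).

Lemma inside_coloring_Blue (e : edge V) :
  inside_coloring A e = Blue -> val e \subset A.
Proof. by rewrite /inside_coloring; case: ifP. Qed.

Lemma inside_coloring_Red (e : edge V) :
  inside_coloring A e = Red -> ~~ (val e \subset A).
Proof. by rewrite /inside_coloring; case: ifP. Qed.

(** Each vertex of a nondegenerate blue cycle is an end of one of its edges, and that edge lies in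
    [A]. Only a degenerate single vertex can escape [A]. *)
Lemma blue_cycle_sub (H : subgraph V) :
  Defs.mono_cycle (inside_coloring A) Blue H ->
  (exists v, H.1 = [set v]) \/ H.1 \subset A.
Proof.
case=> [v|e /inside_coloring_Blue eA|s us s_gt2 sB]; first by left; exists v.
  by right.
right; apply/subsetP => x; rewrite inE => xs.
have [e eE es] := cycle_edgeP us s_gt2 xs.
by have /inside_coloring_Blue/subsetP := sB e es; apply; rewrite eE set21.
Qed.

Lemma red_cycle_card (H : subgraph V) :
  Defs.mono_cycle (inside_coloring A) Red H ->
  (#|H.1 :&: A| <= maxn 1 #|~: A|)%N.
Proof.
case=> [v|e /inside_coloring_Red eA|s us s_gt2 sR] /=; rewrite leq_max.
- by rewrite -(cards1 v) subset_leq_card ?subsetIl.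
(* A red edge meets [A] in a proper subset of its two ends. *)
- rewrite -ltnS -[X in (_ < X)%N](eqP (valP e)) proper_card //.
  by rewrite properE subsetIl subsetI subxx.
(* The map [next s] is injective and sends the cycle's vertices in [A] outside [A], since two
   successive vertices in [A] would span a blue edge. *)
apply/orP; right; rewrite -(card_imset _ (can_inj (prev_next us))).
apply/subset_leq_card/subsetP => y /imsetP[x /setIP[]].
rewrite inE => xs xA ->{y}; rewrite inE; apply/negP => nxA.
have [e eE es] := cycle_edgeP us s_gt2 xs.
have /inside_coloring_Red/negP := sR e es; apply; rewrite eE.
by apply/subsetP => y /set2P[] ->.
Qed.

Lemma cover_mem (c : edge_coloring V) (k : color) (C : {set subgraph V}) v :
  mono_cycle_cover c k C -> exists2 H, H \in C & v \in H.1.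
Proof. by case=> _ CT; apply/bigcupP; rewrite CT. Qed.

Lemma blue_cover_card (C : {set subgraph V}) :
  A != set0 -> mono_cycle_cover (inside_coloring A) Blue C ->
  (#|~: A| < #|C|)%N.
Proof.
case/set0Pn => a aA Ccov.
have BC : set1 @: (~: A) \subset [set H.1 | H in C].
  apply/subsetP => _ /imsetP[v vA ->].
  have [H HC vH] := cover_mem v Ccov.
  have [[w Hw]|/subsetP/(_ v vH) vA'] := blue_cycle_sub (Ccov.1 H HC).
    by apply/imsetP; exists H; rewrite ?Hw //; move: vH; rewrite Hw => /set1P->.
  by move: vA; rewrite inE vA'.
have [H HC aH] := cover_mem a Ccov.
(* It suffices to count distinct vertex sets of members of [C]. The singletons of [~: A] are among
   them, and the vertex set of a member through [a] is not such a singleton. *)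
apply: leq_trans (leq_imset_card fst (mem C)).
rewrite -(card_imset _ (@set1_inj V)); apply: proper_card.
apply/properP; split=> //; exists H.1; first exact: imset_f.
apply/imsetP => -[v]; rewrite inE => vA HE.
by move: aH; rewrite HE => /set1P av; rewrite -av aA in vA.
Qed.

(** Union bound over the traces on [A] of the members of [C]. *)
Lemma red_cover_card (C : {set subgraph V}) :
  mono_cycle_cover (inside_coloring A) Red C ->
  (#|A| <= #|C| * maxn 1 #|~: A|)%N.
Proof.
move=> Ccov; rewrite -sum_nat_const.
apply: (@leq_trans (\sum_(H in C) #|H.1 :&: A|)); last first.
  by apply: leq_sum => H HC; apply: red_cycle_card (Ccov.1 H HC).
have {1}-> : A = \bigcup_(H in C) (H.1 :&: A).
  apply/setP => x; apply/idP/bigcupP => [xA|[H _ /setIP[]//]].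
  by have [H HC xH] := cover_mem x Ccov; exists H; rewrite // inE xH.
elim/big_rec2: _ => [|H m X _ leX]; first by rewrite cards0.
by rewrite (leq_trans (leq_card_setU _ _)) ?leq_add2l.
Qed.

Lemma inside_coloring_cover_card (m : nat) (k : color) (C : {set subgraph V}) :
  (0 < m)%N -> #|~: A| = m -> #|A| = (m.+1 * m)%N ->
  mono_cycle_cover (inside_coloring A) k C -> (m < #|C|)%N.
Proof.
move=> m_gt0 cB cA; case: k => Ccov.
  have := red_cover_card Ccov.
  by rewrite cB cA (maxn_idPr m_gt0) leq_pmul2r.
by rewrite -cB blue_cover_card // -card_gt0 cA muln_gt0.
Qed.

End InsideColoring.

Lemma sqrt_succ_int (R : realType) (n : nat) :
  (0 < n)%N -> Num.sqrt (n.+1%:R : R) \is a Num.int ->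
  exists2 m : nat, (0 < m)%N & n = (m.+1 * m + m)%N.
Proof.
move=> n_gt0; rewrite intrEge0 ?sqrtr_ge0// => /natrP[p pE].
have : (n.+1%:R : R) = (p ^ 2)%:R by rewrite natrX -pE sqr_sqrtr.
move/eqP; rewrite eqr_nat => /eqP {pE}.
(* Here [n + 1 = p ^ 2]. As [n] is positive, [p] is at least 2, and the witness is [p - 1]. *)
by case: p => [|[|m]] nE; [lia | lia | exists m.+1; lia].
Qed.

(** The radicand is [(m + 1) ^ 2 - 1], strictly between consecutive squares. Strictness on the left
    makes the ceiling [m + 1] rather than [m]. *)
Lemma sqrt_bounds (R : realType) (m : nat) :
  (0 < m)%N -> (m%:R : R) < Num.sqrt (m.+1 * m + m)%:R < (m.+1%:R : R).
Proof.
move=> m_gt0.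
have sqrtX k : (k%:R : R) = Num.sqrt (k ^ 2)%:R.
  by rewrite natrX sqrtr_sqr ger0_norm.
by rewrite (sqrtX m) (sqrtX m.+1) !ltr_sqrt ?ltr0n ?ltr_nat; lia.
Qed.

Theorem mainTheorem2 (R : realType) (n : nat) (n_gt0 : (0 < n)%N)
    (sqrt_int : Num.sqrt (n.+1%:R : R) \is a Num.int) :
  (exists c : edge_coloring 'I_n,
     forall (k : color) (C : {set subgraph 'I_n}),
       mono_cycle_cover c k C ->
       Num.ceil (Num.sqrt (n%:R : R)) <= #|C|%:Z) /\
  (forall A B : {set 'I_n},
     A :|: B = [set: 'I_n] -> [disjoint A & B] ->
     #|A|%:Z = n%:Z - Num.floor (Num.sqrt (n%:R : R)) ->
     #|B|%:Z = Num.floor (Num.sqrt (n%:R : R)) ->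
     forall (k : color) (C : {set subgraph 'I_n}),
       mono_cycle_cover (inside_coloring A) k C ->
       Num.ceil (Num.sqrt (n%:R : R)) <= #|C|%:Z).
Proof.
have [m m_gt0 nE] := sqrt_succ_int n_gt0 sqrt_int.
have /andP[lt_m lt_m1] := sqrt_bounds R m_gt0; rewrite -nE in lt_m lt_m1.
have -> : Num.floor (Num.sqrt (n%:R : R)) = m.
  by apply: floor_def; rewrite -PoszD addn1 !pmulrn in lt_m lt_m1 *; rewrite ltW.
have -> : Num.ceil (Num.sqrt (n%:R : R)) = m.+1.
  by apply: ceil_def; rewrite -addn1 PoszD addrK -PoszD addn1 lt_m ltW.
split=> [|A B ABT ABd cA cB k C Ccov].
  have le_mn : (m.+1 * m <= n)%N by rewrite nE leq_addr.
  (* Any set of this size would do; this one is an initial segment of ['I_n]. *)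
  pose A := [set widen_ord le_mn i | i : 'I_(m.+1 * m)].
  have cA : #|A| = (m.+1 * m)%N.
    by rewrite card_imset ?card_ord // => i j [ij]; apply: val_inj.
  exists (inside_coloring A) => k C Ccov.
  rewrite lez_nat (inside_coloring_cover_card m_gt0 _ cA Ccov) //.
  by rewrite cardsCs setCK cA card_ord nE addKn.
rewrite lez_nat; apply: (inside_coloring_cover_card m_gt0 _ _ Ccov).
  have -> : ~: A = B.
    rewrite -setTD -ABT setDUl setDv set0U.
    by apply/setDidPl; rewrite disjoint_sym.
  by case: cB.
by apply/eqP; rewrite -eqz_nat cA nE PoszD addrK.
Qed.
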